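(* Let $L\in\mathbb{R}^{n\times n}$, $u_0\in\mathbb{R}^n$, $N\ge 1$, $a_k,b_k\in\mathbb{R}^n$ and $c_k\in\mathbb{R}$ for $1\le k\le N$, and let $$g_N(t) = \sum_{k=1}^N a_k\cos(c_k t) + b_k\sin(c_k t).$$ Let $u_N(t)$ be the solution of $\dot u_N(t) = L u_N(t) + g_N(t)$, $u_N(0)=u_0$. Set $A_N = [a_1\ \cdots\ a_N]\in\mathbb{R}^{n\times N}$, $B_N=[b_1\ \cdots\ b_N]\in\mathbb{R}^{n\times N}$ and $C_N=\mathrm{diag}(c_1,\dots,c_N)\in\mathbb{R}^{N\times N}$. Then $$u_N(t) = \begin{bmatrix} I_n & 0\end{bmatrix}\exp\left(t\begin{bmatrix} L & A_N & B_N\\ 0 & 0 & -C_N\\ 0 & C_N & 0\end{bmatrix}\right)\begin{bmatrix} u_0\\ \mathbf{1}\\ 0\end{bmatrix},$$ where $\mathbf{1} = [1\ \cdots\ 1]^{\mathrm T}\in\mathbb{R}^N$.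
   Context: $\exp$ denotes the matrix exponential. The block matrix in the exponent has size $(n+2N)\times(n+2N)$, $[I_n\ \ 0]$ has size $n\times(n+2N)$, and the last vector has blocks of sizes $n$, $N$, $N$. *)

(* Defs.v *)
From HB Require Import structures.
From mathcomp Require Import all_boot all_order all_algebra.
From mathcomp Require Import all_classical all_reals all_analysis.

Set Implicit Arguments.
Unset Strict Implicit.
Unset Printing Implicit Defensive.

Import Order.TTheory GRing.Theory Num.Theory.
Import numFieldNormedType.Exports.

Local Open Scope classical_set_scope.
Local Open Scope ring_scope.

Definition expmx (R : realType) (m : nat) (X : 'M[R]_m) : 'M[R]_m :=
  limn (series (fun k : nat => (k`!%:R : R)^-1 *: X ^+ k)).

(* [u] solves u' = L u + g, u(0) = u0 on the time interval [J] (which should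
   contain 0).  At an endpoint of [J] only continuity is asked for, since
   [is_derive] is a two-sided derivative; for J = ]-oo, +oo[ this is the
   differential equation at every real time. *)
Definition is_ivp_solution (R : realType) (n : nat) (J : interval R)
    (L : 'M[R]_n) (g : R -> 'cV[R]_n) (u0 : 'cV[R]_n) (u : R -> 'cV[R]_n) :
    Prop :=
  [/\ {within [set` J], continuous u},
      forall t : R, interior [set` J] t -> is_derive t 1 u (L *m u t + g t)
    & u 0 = u0].

Definition trig_forcing (R : realType) (n N : nat) (a b : 'I_N -> 'cV[R]_n)
    (c : 'I_N -> R) (t : R) : 'cV[R]_n :=
  \sum_(k < N) (cos (c k * t) *: a k + sin (c k * t) *: b k).

Definition cols_mx (R : realType) (n N : nat) (a : 'I_N -> 'cV[R]_n) :
    'M[R]_(n, N) :=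
  \matrix_(i < n, k < N) a k i ord0.

Definition augmented_mx (R : realType) (n N : nat) (L : 'M[R]_n)
    (A B : 'M[R]_(n, N)) (C : 'M[R]_N) : 'M[R]_(n + (N + N)) :=
  block_mx L (row_mx A B)
           0 (block_mx 0 (- C)
                       C 0).

(* Main.v *)
Require Import Defs.
From HB Require Import structures.
From mathcomp Require Import all_boot all_order all_algebra.
From mathcomp Require Import all_classical all_reals all_analysis.
From mathcomp Require Import ring lra.

Set Implicit Arguments.
Unset Strict Implicit.
Unset Printing Implicit Defensive.

Import Order.TTheory GRing.Theory Num.Theory.
Import numFieldNormedType.Exports.

Local Open Scope classical_set_scope.
Local Open Scope ring_scope.

(** The forcing term is itself produced by a linear system: the vectors
    [x = (cos (c_k t))_k] and [y = (sin (c_k t))_k] satisfy [x' = - C y],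
    [y' = C x], and [g = A x + B y].  Hence the stacked vector
    [v = (u, x, y)] satisfies the homogeneous equation [v' = M v], where [M]
    is the augmented matrix ([augmented_mulmx]), and [v 0 = (u0, 1, 0)].  The
    theorem is the first block of [v t = exp (t M) v 0].

    That last identity holds for every solution of [v' = M v] on an interval
    ([linear_ivp_expmx]).  The [k]-th derivative of [v] is [M ^+ k v], so the
    partial sums of the exponential series applied to [v 0] are exactly the
    Taylor polynomials of [v] at [0], evaluated at [t].  Taylor's formula with
    Cauchy's form of the remainder ([taylor_cauchy]), applied to each
    coordinate, bounds the error by a constant times [(|t| C)^n / n!] with
    [C = m |M|], and this tends to [0].  The argument starts from an
    arbitrary solution and identifies its values, so uniqueness comes with it.

    Since the solution may live on an interval that contains one or both of
    its endpoints, where only continuity is known, derivatives are used in the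
    interior only; this is all that the mean value theorem asks for. *)

(** * Limits and derivatives of matrix-valued functions *)

Lemma cvg_mx (U : ptopologicalType) (m n : nat) (T : Type) (F : set_system T)
    {FF : Filter F} (f : T -> 'M[U]_(m, n)) (l : 'M[U]_(m, n)) :
  (forall i j, f x i j @[x --> F] --> l i j) -> f @ F --> l.
Proof.
move=> fl A [P lP PA].
apply: (@filterS _ F _ (fun x => forall i j, P i j (f x i j))).
  by move=> x Px; exact: PA.
by apply: filter_forall => i; apply: filter_forall => j; exact: fl.
Qed.

Lemma cvg_entry (R : numFieldType) (m n : nat) (T : Type) (F : set_system T)
    {FF : Filter F} (f : T -> 'M[R]_(m, n)) (l : 'M[R]_(m, n)) i j :
  f @ F --> l -> f x i j @[x --> F] --> l i j.
Proof.
move=> fl; apply: (@cvg_comp _ _ _ f (fun M => M i j) _ _ _ fl).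
exact: coord_continuous.
Qed.

Lemma cvg_col_mx (R : numFieldType) (m n p : nat) (T : Type)
    (F : set_system T) {FF : Filter F} (f : T -> 'M[R]_(m, p))
    (g : T -> 'M[R]_(n, p)) (A : 'M[R]_(m, p)) (B : 'M[R]_(n, p)) :
  f @ F --> A -> g @ F --> B -> col_mx (f x) (g x) @[x --> F] --> col_mx A B.
Proof.
move=> fA gB; apply: cvg_mx => i j; case: (split_ordP i) => k ->.
  by rewrite col_mxEu; under eq_fun do rewrite col_mxEu; exact: cvg_entry.
by rewrite col_mxEd; under eq_fun do rewrite col_mxEd; exact: cvg_entry.
Qed.

Lemma cvg_mulmx (R : realFieldType) (m n p : nat) (T : Type)
    (F : set_system T) {FF : Filter F} (f : T -> 'M[R]_(m, n))
    (g : T -> 'M[R]_(n, p)) (A : 'M[R]_(m, n)) (B : 'M[R]_(n, p)) :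
  f @ F --> A -> g @ F --> B -> f x *m g x @[x --> F] --> A *m B.
Proof.
move=> fA gB; apply: cvg_mx => i j.
under eq_fun do rewrite mxE; rewrite mxE.
apply: cvg_big; first exact: add_continuous.
by move=> k _; apply: cvgM; exact: cvg_entry.
Qed.

Lemma is_derive_mxP (R : realFieldType) (V : normedModType R) (m n : nat)
    (f : V -> 'M[R]_(m, n)) (df : 'M[R]_(m, n)) (t v : V) :
  is_derive t v f df <->
  forall i j, is_derive t v (fun x => f x i j) (df i j).
Proof.
split=> [[dvf <-] i j|dfij].
  split; first by move/derivable_mxP : dvf.
  by rewrite derive_mx// mxE.
have dvf : derivable f t v by apply/derivable_mxP => i j; case: (dfij i j).
split=> //; rewrite derive_mx//; apply/matrixP => i j; rewrite mxE.
by case: (dfij i j).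
Qed.

Lemma is_derive_col_mx (R : realFieldType) (V : normedModType R) (m n p : nat)
    (f : V -> 'M[R]_(m, p)) (g : V -> 'M[R]_(n, p)) df dg t v :
  is_derive t v f df -> is_derive t v g dg ->
  is_derive t v (fun x => col_mx (f x) (g x)) (col_mx df dg).
Proof.
move=> /is_derive_mxP fdf /is_derive_mxP gdg; apply/is_derive_mxP => i j.
case: (split_ordP i) => k ->.
  by rewrite col_mxEu; under eq_fun do rewrite col_mxEu.
by rewrite col_mxEd; under eq_fun do rewrite col_mxEd.
Qed.

Lemma is_derive_mulmxl (R : realFieldType) (V : normedModType R)
    (m n p : nat) (A : 'M[R]_(m, n)) (f : V -> 'M[R]_(n, p)) df t v :
  is_derive t v f df -> is_derive t v (fun x => A *m f x) (A *m df).
Proof.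
move=> /is_derive_mxP fdf; apply/is_derive_mxP => i j.
have -> : (fun x => (A *m f x) i j) =
    \sum_(k < n) (fun x => A i k *: f x k j).
  by apply/funext => x; rewrite mxE fct_sumE.
by rewrite mxE; apply: is_derive_sum.
Qed.

(** * Bounds on powers of a matrix *)

Lemma normr_entry_le (R : realFieldType) (m n : nat) (A : 'M[R]_(m, n)) i j :
  `|A i j| <= `|A|.
Proof.
rewrite [leRHS]/Num.Def.normr/= mx_normrE.
exact: (le_bigmax _ (fun ij : 'I_m * 'I_n => `|A ij.1 ij.2|) (i, j)).
Qed.

(** The norm of matrices is the largest absolute value of an entry, which is
    submultiplicative only up to the inner dimension [n]. *)
Lemma ler_normM_mx (R : realFieldType) (m n p : nat) (A : 'M[R]_(m, n))
    (B : 'M[R]_(n, p)) : `|A *m B| <= n%:R * `|A| * `|B|.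
Proof.
rewrite [leLHS]/Num.Def.normr/= mx_normrE.
apply: bigmax_le => [|[i j] _ /=]; first by rewrite !mulr_ge0.
rewrite mxE (le_trans (ler_norm_sum _ _ _))//.
rewrite -mulrA mulr_natl -[X in _ *+ X](card_ord n) -sumr_const.
by apply: ler_sum => k _; rewrite normrM ler_pM// normr_entry_le.
Qed.

Lemma ler_norm_expM_mx (R : realFieldType) (m p : nat) (A : 'M[R]_m)
    (B : 'M[R]_(m, p)) k : `|A ^+ k *m B| <= (m%:R * `|A|) ^+ k * `|B|.
Proof.
elim: k => [|k IHk]; first by rewrite expr0 mul1mx expr0 mul1r.
rewrite exprS -mulmxA (le_trans (ler_normM_mx _ _))//.
by rewrite exprS -[leRHS]mulrA ler_wpM2l// mulr_ge0.
Qed.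

(** * Taylor's formula on an interval *)

Lemma segment_sub_interval (R : realDomainType) (J : interval R) (x y : R) :
  x \in J -> y \in J -> [set` `[Num.min x y, Num.max x y]] `<=` [set` J].
Proof.
move=> xJ yJ z /=; rewrite in_itv/= => zxy.
apply: (interval_is_interval _ _ zxy) => /=.
  by rewrite minEle; case: ifP.
by rewrite maxEle; case: ifP.
Qed.

(** The endpoints [x] and [y] come in either order, so that times before and
    after the initial one are treated alike. *)
Lemma MVT_interval (R : realType) (f df : R -> R) (J : interval R) (x y : R) :
    x \in J -> y \in J -> {within [set` J], continuous f} ->
    (forall s, interior [set` J] s -> is_derive s 1 f (df s)) ->
  exists2 s, s \in `[Num.min x y, Num.max x y] &
    f y - f x = df s * (y - x).
Proof.
move=> + + cf fdf; wlog xy : x y / x <= y => [H xJ yJ|xJ yJ].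
  have [xy|/ltW yx] := lerP x y.
    by have := H _ _ xy xJ yJ; rewrite min_l// max_r.
  have := H _ _ yx yJ xJ; rewrite min_l// max_r// => -[s sxy E].
  by exists s => //; rewrite -[LHS]opprB E -mulrN opprB.
have := segment_sub_interval xJ yJ; rewrite (min_l xy) (max_r xy) => sub.
apply: MVT_segment => //; last exact: continuous_subspaceW cf.
move=> z zxy; apply/fdf/(interiorS sub).
by rewrite interior_itv_bnd.
Qed.

(** Here [f k] is the [k]-th derivative of [f 0].  Let [W s] be the value at
    [y] of the Taylor polynomial of order [K] with base point [s].  Its
    derivative telescopes to the single term [(y - s) ^ K / K! * f K.+1 s], and
    it goes from the Taylor polynomial at [x] to [f 0 y] as [s] goes from [x]
    to [y]; the mean value theorem for [W] is the formula. *)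
Lemma taylor_cauchy (R : realType) (f : nat -> R -> R) (J : interval R)
    (x y : R) (K : nat) :
    x \in J -> y \in J ->
    (forall k, {within [set` J], continuous (f k)}) ->
    (forall k s, interior [set` J] s -> is_derive s 1 (f k) (f k.+1 s)) ->
  exists2 s, s \in `[Num.min x y, Num.max x y] &
    f 0%N y - \sum_(k < K.+1) (k`!%:R)^-1 * (y - x) ^+ k * f k x =
    (K`!%:R)^-1 * (y - s) ^+ K * f K.+1 s * (y - x).
Proof.
move=> xJ yJ cf fdf.
pose W n s : R := \sum_(k < n.+1) (k`!%:R)^-1 * (y - s) ^+ k * f k s.
have cW n : {within [set` J], continuous (W n)}.
  move=> s; apply: cvg_big; first exact: add_continuous.
  move=> k _; apply: cvgM; last exact: cf.
  apply: cvgM; first exact: cvg_cst.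
  apply: (@continuous_subspaceT _ _ _ (fun s => (y - s) ^+ k)) => z.
  apply: (@continuous_comp _ _ _ (fun s => y - s) (fun z => z ^+ k)).
    by apply: cvgB; [exact: cvg_cst|exact: cvg_id].
  exact: exprn_continuous.
have dW n s : interior [set` J] s ->
    is_derive s 1 (W n) ((n`!%:R)^-1 * (y - s) ^+ n * f n.+1 s).
  move=> Js; elim: n => [|n IHn].
    have -> : W 0%N = f 0%N.
      by apply/funext => z; rewrite /W big_ord1 expr0 fact0 invr1 !mul1r.
    by rewrite expr0 fact0 invr1 !mul1r; exact: fdf.
  have -> : W n.+1 = W n +
      (n.+1`!%:R)^-1 *: ((cst y - id) ^+ n.+1 * f n.+1).
    apply/funext => z; rewrite /W big_ord_recr/= -mulrA.
    by rewrite !fctE.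
  (* an instance hypothesis: the derivative of the new term is inferred *)
  have fn := fdf n.+1 s Js.
  apply: is_derive_eq.
  rewrite !fctE sub0r !scalerDr/= /GRing.scale/=.
  have := fact_gt0 n.
  rewrite factS natrM => n0.
  field.
  by rewrite nat1r !pnatr_eq0 -lt0n n0.
have [s sxy E] := MVT_interval xJ yJ (cW K) (dW K).
exists s => //; rewrite -E; congr (_ - _).
rewrite /W big_ord_recl big1 => [|k _].
  by rewrite fact0 invr1 expr0 !mul1r addr0.
by rewrite subrr expr0n/= mulr0 mul0r.
Qed.

(** * The matrix exponential solves linear systems *)

(** The analogue of [exprZn] for a size that may be [0], where matrices form
    the trivial ring. *)
Lemma exprZn_mx (R : comPzRingType) (m : nat) (t : R) (A : 'M[R]_m) k :
  (t *: A) ^+ k = t ^+ k *: A ^+ k.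
Proof.
elim: k => [|k IHk]; first by rewrite !expr0 scale1r.
by rewrite !exprS IHk -[LHS]/(_ *m _) -scalemxAl -scalemxAr scalerA.
Qed.

(** [expmx] is a total limit, so its series has to be shown convergent.  Each
    entry of the series is dominated by a scalar exponential series: the
    entries of [X ^+ k = X ^+ k *m 1] are at most [(m |X|)^k |1|]. *)
Lemma cvg_expmx (R : realType) (m : nat) (X : 'M[R]_m) :
  series (fun k : nat => (k`!%:R : R)^-1 *: X ^+ k) @ \oo --> expmx X.
Proof.
set e := fun k : nat => _.
suff eij i j : cvgn (series (fun k => e k i j)).
  apply/cvg_ex; exists (\matrix_(i, j) limn (series (fun k => e k i j))).
  apply: cvg_mx => i j; rewrite mxE.
  suff -> : (fun k => series e k i j) = series (fun k => e k i j).
    exact: eij.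
  by apply/funext => k; rewrite /series/= summxE.
apply: normed_cvg.
pose v := `|1%:M : 'M[R]_m| *: exp_coeff (m%:R * `|X|).
have v_ge0 k : 0 <= v k.
  by rewrite /v/= mulr_ge0// exp_coeff_ge0// mulr_ge0.
apply: (series_le_cvg _ v_ge0) => [k| k|] /=.
- exact: normr_ge0.
- rewrite (le_trans (normr_entry_le _ _ _))// /e normrZ.
  rewrite ger0_norm ?invr_ge0// /v mulrC /exp_coeff/=.
  rewrite [leRHS]mulrA ler_wpM2r ?invr_ge0//.
  by rewrite -[X ^+ k]mulmx1 (le_trans (ler_norm_expM_mx _ _ _))// mulrC.
- exact/is_cvg_seriesZ/is_cvg_series_exp_coeff.
Qed.

(** The derivatives of [v] are the [A ^+ k *m v], so the partial sums of the
    exponential series applied to [v 0] are Taylor polynomials of [v].  On the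
    segment between [0] and [t] the [n.+1]-st derivative is at most
    [C ^+ n.+1 * B], where [B] bounds [v] there by compactness and
    [C = m |A|]; the factorial in the remainder beats this growth. *)
Lemma linear_ivp_expmx (R : realType) (m : nat) (A : 'M[R]_m)
    (v : R -> 'cV[R]_m) (J : interval R) (t : R) :
    0 \in J -> t \in J -> {within [set` J], continuous v} ->
    (forall s, interior [set` J] s -> is_derive s 1 v (A *m v s)) ->
  v t = expmx (t *: A) *m v 0.
Proof.
move=> J0 Jt cv dv; apply/matrixP => i j.
pose S := series (fun k : nat => (k`!%:R : R)^-1 *: (t *: A) ^+ k).
pose f k s := (A ^+ k *m v s) i j.
have cf k : {within [set` J], continuous (f k)}.
  move=> s; apply: (cvg_entry (l := A ^+ k *m v s)).
  by apply: (cvg_mulmx (f := fun=> A ^+ k)); [exact: cvg_cst|exact: cv].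
have df k s : interior [set` J] s -> is_derive s 1 (f k) (f k.+1 s).
  move=> Js; rewrite /f exprSr -mulmxA.
  by have /is_derive_mxP := is_derive_mulmxl (A ^+ k) (dv s Js); exact.
have [B vB] : exists B, forall s,
    s \in `[Num.min 0 t, Num.max 0 t] -> `|v s| <= B.
  have cI : compact (v @` `[Num.min 0 t, Num.max 0 t]).
    apply: continuous_compact; last exact: segment_compact.
    apply: continuous_subspaceW cv; exact: segment_sub_interval.
  have [B [_ vB]] := compact_bounded cI.
  (* boundedness gives a bound by every number above [B] *)
  exists (B + 1) => s sI; apply: vB; first by rewrite ltrDl.
  by exists s.
pose C := m%:R * `|A|.
(* the partial sum [S n.+1] has last term of order [n] *)
pose d n := v t i j - (S n.+1 *m v 0) i j.
have dE n : exists2 s, s \in `[Num.min 0 t, Num.max 0 t] &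
    d n = (n`!%:R)^-1 * (t - s) ^+ n * f n.+1 s * t.
  have [s sI E] := taylor_cauchy n J0 Jt cf df.
  exists s => //; rewrite subr0 in E; rewrite -E /d {1}/f expr0 mul1mx.
  congr (_ - _); rewrite /S /series/= big_mkord mulmx_suml summxE.
  apply: eq_bigr => k _.
  by rewrite exprZn_mx -!scalemxAl scalerA [LHS]mxE.
have d_le n : `|d n| <= exp_coeff (`|t| * C) n * (C * B * `|t|).
  have [s sI ->] := dE n.
  have ts : `|t - s| <= `|t|.
    move: sI; rewrite in_itv/=.
    by have [t0|t0] := leP 0 t => /andP[s1 s2];
      rewrite ler_norml ?(ger0_norm t0) ?(ltr0_norm t0); lra.
  have fs : `|f n.+1 s| <= C ^+ n.+1 * B.
    rewrite (le_trans (normr_entry_le _ _ _))//.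
    rewrite (le_trans (ler_norm_expM_mx _ _ _))//.
    by rewrite ler_wpM2l ?vB// exprn_ge0// mulr_ge0.
  rewrite !normrM normrX ger0_norm ?invr_ge0// /exp_coeff/= exprMn.
  have -> : `|t| ^+ n * C ^+ n / n`!%:R * (C * B * `|t|) =
      (n`!%:R)^-1 * `|t| ^+ n * (C ^+ n.+1 * B) * `|t| by rewrite exprS; ring.
  rewrite ler_wpM2r// ler_pM// ?mulr_ge0 ?invr_ge0 ?exprn_ge0//.
  by rewrite ler_wpM2l ?invr_ge0// lerXn2r ?nnegrE.
have d0 : d @ \oo --> 0.
  have e0 : exp_coeff (`|t| * C) n * (C * B * `|t|) @[n --> \oo] --> 0.
    rewrite -[X in _ --> X](mul0r (C * B * `|t|)).
    by apply: cvgMl; exact: cvg_exp_coeff.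
  apply: (squeeze_cvgr _ _ e0); last first.
    by rewrite -oppr0; exact: cvgN e0.
  by apply: nearW => n; rewrite -ler_norml.
have dl : d @ \oo --> v t i j - (expmx (t *: A) *m v 0) i j.
  apply: cvgB; first exact: cvg_cst.
  rewrite (@cvg_shiftS _ (fun n => (S n *m v 0) i j)).
  apply: (cvg_entry (l := expmx (t *: A) *m v 0)).
  by apply: (cvg_mulmx (g := fun=> v 0)); [exact: cvg_expmx|exact: cvg_cst].
by apply/eqP; rewrite -subr_eq0; apply/eqP; exact: (cvg_unique _ dl d0).
Qed.

(** * The augmented system *)

Lemma augmented_mulmx (R : realType) (n N : nat) (L : 'M[R]_n)
    (a b : 'I_N -> 'cV[R]_n) (c : 'I_N -> R) (x : 'cV[R]_n) (t : R) :
  augmented_mx L (cols_mx a) (cols_mx b) (diag_mx (\row_k c k))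
    *m col_mx x (col_mx (\col_k cos (c k * t)) (\col_k sin (c k * t))) =
  col_mx (L *m x + trig_forcing a b c t)
    (col_mx (\col_k (- (c k * sin (c k * t)))) (\col_k (c k * cos (c k * t)))).
Proof.
rewrite /augmented_mx !mul_block_col !mul0mx !add0r addr0 mul_row_col mulNmx.
congr col_mx; last first.
  by congr col_mx; apply/matrixP => k j; rewrite mul_diag_mx !mxE.
congr (_ + _); apply/matrixP => i j; rewrite (ord1 j) /trig_forcing.
rewrite mxE summxE !mxE -big_split/=; apply: eq_bigr => k _.
by rewrite !mxE mulrC [X in _ + X]mulrC.
Qed.

Lemma is_derive_trig_osc (R : realType) (N : nat) (c : 'I_N -> R) (t : R) :
  is_derive t 1
    (fun s => col_mx (\col_k cos (c k * s)) (\col_k sin (c k * s))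
              : 'cV[R]_(N + N))
    (col_mx (\col_k (- (c k * sin (c k * t)))) (\col_k (c k * cos (c k * t)))).
Proof.
have dc k : is_derive t 1 (fun s => c k * s) (c k).
  by apply: is_derive_eq; rewrite /GRing.scale/= mulr1.
apply/is_derive_mxP => i j.
case: (split_ordP i) => k ->.
  rewrite col_mxEu mxE mulrC -mulNr.
  under eq_fun do rewrite col_mxEu mxE.
  exact: is_derive1_comp.
rewrite col_mxEd mxE mulrC.
under eq_fun do rewrite col_mxEd mxE.
exact: is_derive1_comp.
Qed.

Theorem theorem10 (R : realType) (n N : nat) (hN : (1 <= N)%N)
    (L : 'M[R]_n) (u0 : 'cV[R]_n) (a b : 'I_N -> 'cV[R]_n) (c : 'I_N -> R)
    (J : interval R) (J0 : 0 \in J) (uN : R -> 'cV[R]_n)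
    (huN : is_ivp_solution J L (trig_forcing a b c) u0 uN) (t : R)
    (tJ : t \in J) :
  uN t =
    row_mx 1%:M (0 : 'M[R]_(n, N + N))
    *m expmx (t *: augmented_mx L (cols_mx a) (cols_mx b)
                                (diag_mx (\row_(k < N) c k)))
    *m col_mx u0 (col_mx (const_mx 1 : 'cV[R]_N) (0 : 'cV[R]_N)).
Proof.
case: huN => cu du u_0.
pose y s : 'cV[R]_(N + N) :=
  col_mx (\col_k cos (c k * s)) (\col_k sin (c k * s)).
pose v s := col_mx (uN s) (y s).
have v0 : v 0 = col_mx u0 (col_mx (const_mx 1) 0).
  rewrite /v u_0; congr col_mx; congr col_mx; apply/matrixP => k j;
    by rewrite !mxE mulr0 ?cos0 ?sin0.
have cy : continuous y.
  move=> s; apply/differentiable_continuous/derivable1_diffP.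
  by case: (is_derive_trig_osc c s).
have cv : {within [set` J], continuous v}.
  by move=> s; apply: cvg_col_mx; [exact: cu|exact: (continuous_subspaceT cy)].
have dv s : interior [set` J] s -> is_derive s 1 v
    (augmented_mx L (cols_mx a) (cols_mx b) (diag_mx (\row_k c k)) *m v s).
  move=> Js; rewrite augmented_mulmx.
  by apply: is_derive_col_mx; [exact: du|exact: is_derive_trig_osc].
rewrite -v0 -mulmxA -(linear_ivp_expmx J0 tJ cv dv).
by rewrite mul_row_col mul1mx mul0mx addr0.
Qed.
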